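(* Let $X_1,\dots,X_p$ be independent random variables, $X_i$ valued in a measurable space $E_i$, let $f:E_1\times\dots\times E_p\to\mathbb R^k$ be measurable, and assume that $Y=f(X_1,\dots,X_p)$ satisfies $\mathbb E(\|Y\|^2)<\infty$ and has positive definite covariance matrix. Let $\mathbf u\subset\{1,\dots,p\}$. Then the Pick and Freeze estimator $S_{\mathbf u,N}$ converges almost surely to $S^{\mathbf u}(f)$ when $N\to+\infty$.
   Context: For $\mathbf u\subset\{1,\dots,p\}$, $X_{\mathbf u}=(X_i,\ i\in\mathbf u)$ and $\sim\!\mathbf u$ is the complement of $\mathbf u$. $\Sigma$ is the covariance matrix of $Y$, $C_{\mathbf u}$ is the covariance matrix of $\mathbb E(Y\mid X_{\mathbf u})$, and $S^{\mathbf u}(f)=\mathrm{Tr}(C_{\mathbf u})/\mathrm{Tr}(\Sigma)$. Set $Y^{\mathbf u}=f(X_{\mathbf u},X'_{\sim\mathbf u})$, where $X'_{\sim\mathbf u}$ is an independent copy of $X_{\sim\mathbf u}$, also independent of $X_{\mathbf u}$. Let $(Y_i,Y_i^{\mathbf u})_{i\ge1}$ be i.i.d. copies of the pair $(Y,Y^{\mathbf u})$, and let $Y_{i,l}$, $Y_{i,l}^{\mathbf u}$ be the $l$-th components of $Y_i$, $Y_i^{\mathbf u}$. The Pick and Freeze estimator is $$S_{\mathbf u,N}=\frac{\sum_{l=1}^k\left(\frac1N\sum_{i=1}^NY_{i,l}Y_{i,l}^{\mathbf u}-\left(\frac1N\sum_{i=1}^N\frac{Y_{i,l}+Y_{i,l}^{\mathbf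 u}}2\right)^2\right)}{\sum_{l=1}^k\left(\frac1N\sum_{i=1}^N\frac{Y_{i,l}^2+(Y_{i,l}^{\mathbf u})^2}2-\left(\frac1N\sum_{i=1}^N\frac{Y_{i,l}+Y_{i,l}^{\mathbf u}}2\right)^2\right)} .$$ *)

(* Defs.v *)
From HB Require Import structures.
From mathcomp Require Import all_boot all_order all_algebra finmap.
From mathcomp Require Import all_classical all_reals all_analysis measurable_realfun.

Set Implicit Arguments.
Unset Strict Implicit.
Unset Printing Implicit Defensive.

Import Order.TTheory GRing.Theory Num.Theory.

Local Open Scope classical_set_scope.
Local Open Scope ring_scope.

Section product_space.
Context {I : Type} {d : I -> measure_display}.
Variable E : forall i, measurableType (d i).

Definition cylinders : set (set (forall i, E i)) :=
  \bigcup_(i in [set: I])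
    preimage_set_system setT (fun x : forall i, E i => x i) measurable.

Definition prod_space : measurableType _ := g_sigma_algebraType cylinders.

End product_space.

Section sub_products.
Context {p : nat} {d : 'I_p -> measure_display}.
Variables (E : forall i, measurableType (d i)) (u : {set 'I_p}).

Definition sub_space (v : {set 'I_p}) : measurableType _ :=
  prod_space (fun i : {i | i \in v} => E (val i)).

Definition sub_vec (v : {set 'I_p}) (x : prod_space E) : sub_space v :=
  fun i => x (val i).

Let in_compl (i : 'I_p) : (i \in u) = false -> i \in ~: u.
Proof. by rewrite finset.in_setC => ->. Qed.

(* The point of the full product with u-coordinates a and other ones b. *)
Definition glue (a : sub_space u) (b : sub_space (~: u)) : prod_space E :=
  fun i => (if i \in u as c return (i \in u) = c -> E i
            then fun h => a (exist _ i h)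
            else fun h => b (exist _ i (in_compl h))) erefl.

Lemma glueK (x : prod_space E) : glue (sub_vec x) (sub_vec x) = x.
Proof.
apply: functional_extensionality_dep => i; rewrite /glue /sub_vec /=.
by case: (i \in u).
Qed.

End sub_products.
Arguments sub_vec {p d E} v x.
Arguments glue {p d E u} a b.

Section random_elements.
Context {dO : measure_display} {Omega : measurableType dO} {R : realType}.
Variable P : probability Omega R.

Definition mutually_independent (I : choiceType) (d : I -> measure_display)
    (E : forall i, measurableType (d i)) (X : forall i, Omega -> E i) : Prop :=
  forall (J : {fset I}) (A : forall i, set (E i)),
    (forall i, i \in J -> measurable (A i)) ->
    P (\bigcap_(i in [set` J]) X i @^-1` A i)
      = (\prod_(i <- J) P (X i @^-1` A i))%E.

Definition independent2 (d1 d2 : measure_display) (T1 : measurableType d1)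
    (T2 : measurableType d2) (X1 : Omega -> T1) (X2 : Omega -> T2) : Prop :=
  forall A B, measurable A -> measurable B ->
    P (X1 @^-1` A `&` X2 @^-1` B) = (P (X1 @^-1` A) * P (X2 @^-1` B))%E.

Definition same_law (d1 : measure_display) (T1 : measurableType d1)
    (X1 X2 : Omega -> T1) : Prop :=
  forall A, measurable A -> pushforward P X1 A = pushforward P X2 A.

Section conditional_expectation.
Context {d1 : measure_display} {T1 : measurableType d1}.

(* V is a version of E(Y | Z): it is sigma(Z)-measurable, integrable, and has
   the same integral as Y over every event of sigma(Z). *)
Definition is_cond_exp (Y : Omega -> R) (Z : Omega -> T1) (V : Omega -> R) :
    Prop :=
  [/\ measurable_fun [set: g_sigma_algebra_preimageType Z] V,
      P.-integrable setT (EFin \o V) &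
      forall A, g_sigma_algebra_preimage Z A ->
        (\int[P]_(w in A) (V w)%:E = \int[P]_(w in A) (Y w)%:E)%E].

(* A chosen version; see cond_expP for existence. *)
Definition cond_exp (Y : Omega -> R) (Z : Omega -> T1) : Omega -> R :=
  xget (fun=> 0) (is_cond_exp Y Z).

Lemma cond_expP (Y : Omega -> R) (Z : Omega -> T1) :
  measurable_fun setT Z -> P.-integrable setT (EFin \o Y) ->
  is_cond_exp Y Z (cond_exp Y Z).
Proof.
move=> mZ iY; apply: xgetPex.
pose GT := g_sigma_algebra_preimageType Z.
pose id' : Omega -> GT := id.
have mid' : measurable_fun [set: Omega] id'.
  by move=> _ _ [B mB <-]; rewrite !setTI -[X in measurable X]setTI; exact: mZ.
pose idG : {mfun Omega >-> GT} :=
  HB.pack id' (isMeasurableFun.Build _ _ _ _ _ mid').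
pose mu : probability GT R := distribution P idG.
pose nu0 : {charge set Omega -> \bar R} := induced_charge iY.
pose nuG : {charge set GT -> \bar R} := pushforward nu0 idG.
pose nu := nuG mid'.
have numu : nu `<< mu.
  apply: (dominates_pushforward (f := idG)) => //.
  apply/null_content_dominatesP => A mA PA0.
  apply: null_set_integral => //.
  exact: measurable_funTS (measurable_int _ iY).
pose g : GT -> \bar R := Radon_Nikodym nu mu.
have gfin x : g x \is a fin_num by exact: Radon_Nikodym_fin_num.
have ig := Radon_Nikodym_integrable numu.
have mg : measurable_fun [set: GT] g by exact: measurable_int ig.
pose V := fine \o g.
have VE : EFin \o V = g.
  by apply/funext => x; rewrite /= fineK.
have iV : P.-integrable setT (EFin \o V).
  apply/integrableP; split.
    by rewrite VE; exact: (measurableT_comp mg mid').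
  move/integrableP : ig => [_]; rewrite ge0_integral_pushforward//.
    by rewrite VE.
  exact: measurableT_comp.
exists V; split => //; first exact: measurableT_comp.
move=> A GA.
have mA : measurable (A : set GT) by [].
transitivity (\int[mu]_(w in A) g w)%E.
  rewrite integral_pushforward//; last first.
    rewrite /= -VE; apply: (integrableS measurableT _ _ iV) => //.
    by have := mid' measurableT A mA; rewrite setTI.
  by apply: eq_integral => w _; rewrite -VE.
by rewrite -Radon_Nikodym_integral.
Qed.

Definition cond_exp_vec (k : nat) (Y : Omega -> k.-tuple R) (Z : Omega -> T1) :
    Omega -> k.-tuple R :=
  fun w => [tuple cond_exp (fun w' => tnth (Y w') l) Z w | l < k].

End conditional_expectation.

Definition cov_mx (k : nat) (Y : Omega -> k.-tuple R) : 'M[R]_k :=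
  \matrix_(i, j)
    fine (covariance P (fun w => tnth (Y w) i) (fun w => tnth (Y w) j)).

End random_elements.

Definition posdef (R : realType) (k : nat) (M : 'M[R]_k) : Prop :=
  M^T = M /\ forall v : 'cV[R]_k, v != 0 -> 0 < (v^T *m M *m v) 0 0.

Definition eucl_norm (R : realType) (k : nat) (y : k.-tuple R) : R :=
  Num.sqrt (\sum_(l < k) tnth y l ^+ 2).

Section sobol.
Context {dO : measure_display} {Omega : measurableType dO} {R : realType}.
Variable P : probability Omega R.
Context {p k : nat} {d : 'I_p -> measure_display}.
Variable E : forall i, measurableType (d i).
Implicit Types (f : prod_space E -> k.-tuple R) (X : forall i, Omega -> E i).

Definition joint X : Omega -> prod_space E := fun w i => X i w.

Definition output f X : Omega -> k.-tuple R := fun w => f (joint X w).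

Definition sub_input X (v : {set 'I_p}) : Omega -> sub_space E v :=
  fun w => sub_vec v (joint X w).
Arguments sub_input : clear implicits.

Definition frozen_output f X (u : {set 'I_p})
    (X' : Omega -> sub_space E (~: u)) : Omega -> k.-tuple R :=
  fun w => f (glue (sub_input X u w) (X' w)).

Definition sobol f X (u : {set 'I_p}) : R :=
  \tr (cov_mx P (cond_exp_vec P (output f X) (sub_input X u)))
  / \tr (cov_mx P (output f X)).

End sobol.
Arguments sub_input {dO Omega p d E} X v w.

(* Samples are indexed from 0, so that the sums run over i = 0, ..., N - 1. *)
Definition pick_freeze (R : realType) (k : nat) (y yu : nat -> k.-tuple R)
    (N : nat) : R :=
  (\sum_(l < k)
     (N%:R^-1 * (\sum_(i < N) tnth (y i) l * tnth (yu i) l)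
      - (N%:R^-1 * \sum_(i < N) (tnth (y i) l + tnth (yu i) l) / 2) ^+ 2))
  / (\sum_(l < k)
     (N%:R^-1 * (\sum_(i < N) (tnth (y i) l ^+ 2 + tnth (yu i) l ^+ 2) / 2)
      - (N%:R^-1 * \sum_(i < N) (tnth (y i) l + tnth (yu i) l) / 2) ^+ 2)).

(* Main.v *)
(* The law of large numbers, applied to each coordinate, shows that S_{u,N}
   tends to (sum_l E[Y_l Y_l^u] - E[Y_l]^2) / (sum_l E[Y_l^2] - E[Y_l]^2), since
   Y^u has the law of Y.  Put g_l(a) = E[f_l(a, X_{~u})]; then g_l(X_u) is a
   version of E(Y_l | X_u), and by Fubini, integrating first over the
   independent copies of X_{~u} at fixed X_u = a, E[Y_l Y_l^u] = E[g_l(X_u)^2].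
   So the numerator is Tr(C_u).

   The law of large numbers follows from a maximal ergodic argument: if
   E[xi_0] < 0, let M_n be the maximum of 0 and the first n partial sums, M'_n
   the same for the shifted sequence, and A the event that M_n is unbounded.
   A is shift invariant, so M_(n+1) - M'_n = max(0, xi_0 + M'_n) - M'_n has
   nonnegative integral over A, and in the limit 0 <= E[xi_0 1_A].  As A
   depends on xi_1, xi_2, ... only, this is E[xi_0] P(A), whence P(A) = 0. *)
Require Import Defs.
From HB Require Import structures.
From mathcomp Require Import all_boot all_order all_algebra finmap.
From mathcomp Require Import all_classical all_reals all_analysis measurable_realfun.
From mathcomp Require Import ring lra.
Import Order.TTheory GRing.Theory Num.Theory.
Import numFieldNormedType.Exports.
Local Open Scope classical_set_scope.
Local Open Scope ring_scope.

Set Implicit Arguments.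
Unset Strict Implicit.
Unset Printing Implicit Defensive.

(** * Product spaces and pi-systems *)

Section coordinates.
Context (I : Type) (d : I -> measure_display)
  (E : forall i, measurableType (d i)).

Lemma measurable_coord (i : I) :
  measurable_fun setT (fun x : prod_space E => x i).
Proof.
move=> _ B mB; rewrite setTI; apply: sub_sigma_algebra; exists i => //.
by exists B => //; rewrite setTI.
Qed.

(** The cylinders generate the product sigma-algebra, so only preimages of cylinders have to be
    tested. *)
Lemma measurable_to_prod_space (dT : measure_display) (T : measurableType dT)
    (g : T -> prod_space E) :
  (forall i, measurable_fun setT (fun t => g t i)) -> measurable_fun setT g.
Proof.
move=> mg; apply: (@measurability _ _ T (prod_space E) setT g (@cylinders _ _ E)) => //.
move=> _ [_ [i _ [B mB <-]] <-]; rewrite setTI.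
by have := mg i measurableT B mB; rewrite !setTI.
Qed.

End coordinates.

Section pi_systems.
Context (dO : measure_display) (Omega : measurableType dO) (R : realType)
  (P : probability Omega R) (dT : measure_display) (T : measurableType dT)
  (G : set (set T)).
Hypotheses (mG : @measurable _ T = <<s G >>) (GI : setI_closed G) (GT : G setT).

(** Uniqueness of finite measures on a pi-system: since [G] contains [setT], the constant sequence
    [setT] is an exhausting sequence of finite measure. *)
Lemma same_law_generated (X Y : Omega -> T) :
  measurable_fun setT X -> measurable_fun setT Y ->
  (forall A, G A -> P (X @^-1` A) = P (Y @^-1` A)) -> same_law P X Y.
Proof.
move=> mX mY XY A mA.
pose X' : {mfun Omega >-> T} := HB.pack X (isMeasurableFun.Build _ _ _ _ _ mX).
pose Y' : {mfun Omega >-> T} := HB.pack Y (isMeasurableFun.Build _ _ _ _ _ mY).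
apply: (measure_unique G (fun=> setT) mG GI _ _
  (distribution P X') (distribution P Y')) => //.
- by rewrite bigcup_const//; exists 0%N.
- by move=> _; rewrite /= probability_setT ltry.
Qed.

(** As functions of [A], both sides are finite measures: the image under [X] of [P] restricted to
    [Z], and the law of [X] scaled by [P Z]. Agreement on the pi-system [G] therefore suffices. *)
Lemma independent_event_generated (X : Omega -> T) (Z : set Omega) :
  measurable_fun setT X -> measurable Z ->
  (forall A, G A -> P (X @^-1` A `&` Z) = (P (X @^-1` A) * P Z)%E) ->
  forall A, measurable A -> P (X @^-1` A `&` Z) = (P (X @^-1` A) * P Z)%E.
Proof.
move=> mX mZ XZ A mA.
pose X' : {mfun Omega >-> T} := HB.pack X (isMeasurableFun.Build _ _ _ _ _ mX).
have PZ : (fine (P Z))%:E = P Z by rewrite fineK// fin_num_measure.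
pose r := NngNum (fine_ge0 (measure_ge0 P Z)).
rewrite muleC -PZ.
pose m0 : {measure set T -> \bar R} := pushforward (mrestr P mZ) X.
pose m1 := m0 mX.
pose m2 : {measure set T -> \bar R} := mscale r (distribution P X').
suff : m1 A = m2 A by [].
apply: (measure_unique G (fun=> setT) mG GI _ _ m1 m2) => //.
- by rewrite bigcup_const//; exists 0%N.
- by move=> B GB; rewrite /m1 /m0 /m2 /= /pushforward /mrestr XZ// /mscale /= PZ muleC.
- move=> _; rewrite /m1 /m0 /= /pushforward /mrestr.
  by rewrite preimage_setT setTI (le_lt_trans (probability_le1 P mZ)) ?ltry.
Qed.

End pi_systems.

Section boxes.
Context (I : choiceType) (d : I -> measure_display)
  (E : forall i, measurableType (d i)).

(* Boxes are indexed by families over all of I, even though they live in the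
   product over J, so that two boxes over disjoint parts of I glue into one. *)
Definition is_box (K : {fset I}) (A : forall i, set (E i)) : Prop :=
  (forall i, measurable (A i)) /\ (forall i, i \notin K -> A i = setT).

Definition box (J : Type) (phi : J -> I) (A : forall i, set (E i)) :
    set (prod_space (fun j => E (phi j))) :=
  [set x | forall j, A (phi j) (x j)].
Arguments box {J} phi A.

Definition boxes (J : Type) (phi : J -> I) :
    set (set (prod_space (fun j => E (phi j)))) :=
  [set B | exists K A, is_box K A /\ B = box phi A].
Arguments boxes {J} phi.

Lemma boxesT (J : Type) (phi : J -> I) : boxes phi setT.
Proof.
by exists fset0, (fun=> setT); split => //; apply/seteqP; split.
Qed.

Lemma boxesI (J : Type) (phi : J -> I) : setI_closed (boxes phi).
Proof.
move=> _ _ [K [A [[mA AT] ->]]] [L [B [[mB BT] ->]]].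
exists (K `|` L)%fset, (fun i => A i `&` B i); split; first split.
- by move=> i; exact: measurableI.
- by move=> i; rewrite in_fsetU negb_or => /andP[/AT -> /BT ->]; rewrite setIT.
- apply/seteqP; split => [x [xA xB] j|x xAB]; first by split.
  by split=> j; have [] := xAB j.
Qed.

Lemma is_box_dfwith (i : I) (B : set (E i)) :
  measurable B -> is_box [fset i]%fset (@dfwith I (fun j => set (E j)) (fun=> setT) _ B).
Proof.
move=> mB; split=> [j|j]; first by case: dfwithP.
by rewrite in_fset1 eq_sym => ij; rewrite dfwithout.
Qed.

(** A generating cylinder is a box with one constrained coordinate; injectivity of [phi] keeps that
    constraint from reaching a second coordinate. Conversely, a box is a finite intersection, over
    [K], of one-coordinate conditions. *)
Lemma measurable_boxes (J : Type) (phi : J -> I) : injective phi ->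
  @measurable _ (prod_space (fun j => E (phi j))) = <<s boxes phi >>.
Proof.
move=> phi_inj; apply/seteqP; split.
  apply: smallest_sub; first exact: smallest_sigma_algebra.
  move=> _ [j _ [B mB <-]]; apply: sub_sigma_algebra.
  exists [fset phi j]%fset, (@dfwith I (fun j => set (E j)) (fun=> setT) _ B).
  split; first exact: is_box_dfwith.
  rewrite setTI; apply/seteqP; split => [x /= xB j'|x /(_ j)].
    have [jj'|jj'] := eqVneq (phi j) (phi j'); last by rewrite dfwithout.
    by rewrite -(phi_inj _ _ jj') dfwithin.
  by rewrite dfwithin.
apply: smallest_sub; first exact: sigma_algebra_measurable.
move=> _ [K [A [[mA AT] ->]]].
have -> : box phi A =
    \bigcap_(i in [set` K]) [set x | forall j, phi j = i -> A (phi j) (x j)].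
  apply/seteqP; split => [x xA i _ j _|x xA j]; first exact: xA.
  have [jK|/AT ->//] := boolP (phi j \in K).
  by have := xA _ jK j erefl.
apply: fin_bigcap_measurable => // i _.
(* An index of [K] outside the range of [phi] imposes no condition on the product over [J]. *)
have [[j <-]|nj] := pselect (exists j, phi j = i).
  rewrite [X in measurable X](_ : _ =
    (fun x : prod_space (fun j => E (phi j)) => x j) @^-1` A (phi j)).
    by rewrite -[X in measurable X]setTI; exact: measurable_coord.
  apply/seteqP; split => [x /(_ j erefl)//|x xA j' /phi_inj ->//].
rewrite [X in measurable X](_ : _ = setT)//; apply/seteqP; split => // x _ j ij.
by case: nj; exists j.
Qed.

End boxes.
Arguments box {I d E J} phi A.
Arguments boxes {I d E J} phi.

(** * Independence of disjoint blocks of an independent family *)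

Section families.
Context (dO : measure_display) (Omega : measurableType dO) (R : realType)
  (P : probability Omega R) (I : choiceType) (d : I -> measure_display)
  (E : forall i, measurableType (d i)).

Definition subfamily (J : Type) (phi : J -> I) (X : forall i, Omega -> E i) :
    Omega -> prod_space (fun j => E (phi j)) := fun w j => X (phi j) w.
Arguments subfamily {J} phi X.

Variable X : forall i, Omega -> E i.
Hypotheses (mX : forall i, measurable_fun setT (X i))
  (indX : mutually_independent P X).

Lemma measurable_subfamily (J : Type) (phi : J -> I) :
  measurable_fun setT (subfamily phi X).
Proof. by apply: measurable_to_prod_space => j; exact: mX. Qed.

(** Any finite [K] containing the constrained indices will do, so two boxes can be evaluated over a
    common index set. *)
Lemma prob_box (K : {fset I}) (A : forall i, set (E i)) : is_box K A ->
  P (\bigcap_i X i @^-1` A i) = (\prod_(i <- K) P (X i @^-1` A i))%E.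
Proof.
move=> [mA AT]; rewrite -indX//; congr (P _).
apply/seteqP; split => [w wA i _|w wA i _]; first exact: wA.
by have [iK|/AT ->//] := boolP (i \in K); exact: wA.
Qed.

Lemma subfamily_box (J : Type) (phi : J -> I) (A : forall i, set (E i)) :
  subfamily phi X @^-1` box phi A =
  \bigcap_i X i @^-1` (if `[< exists j, phi j = i >] then A i else setT).
Proof.
apply/seteqP; split => [w wA i _|w wA j].
  by case: ifPn => //= /asboolP[j <-]; exact: wA.
have := wA (phi j) Logic.I; rewrite ifT//; apply/asboolP; by exists j.
Qed.

(** The pi-system argument is applied to each block in turn, which reduces the claim to boxes. Boxes
    over the two blocks constrain disjoint sets of indices, so the product over [K] and [L] together
    factors index by index. *)
Lemma independent2_blocks (J1 J2 : Type) (phi1 : J1 -> I) (phi2 : J2 -> I) :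
  injective phi1 -> injective phi2 -> (forall i j, phi1 i <> phi2 j) ->
  independent2 P (subfamily phi1 X) (subfamily phi2 X).
Proof.
move=> inj1 inj2 phi12 A B mA mB.
have mT := measurable_subfamily.
move: A mA; apply: (independent_event_generated (measurable_boxes E inj1)
  (@boxesI _ _ _ _ phi1) (@boxesT _ _ _ _ phi1)) => //.
- by rewrite -[X in measurable X]setTI; exact: mT.
(* The roles are exchanged so that the same lemma now frees [B], with [A] reduced to a box. *)
move=> A GA; rewrite setIC muleC.
move: B mB; apply: (independent_event_generated (measurable_boxes E inj2)
  (@boxesI _ _ _ _ phi2) (@boxesT _ _ _ _ phi2)) => //.
- rewrite -[X in measurable X]setTI; apply: mT => //.
  by rewrite (measurable_boxes E inj1); exact: sub_sigma_algebra.
move=> B [L [B' [[mB BT] ->]]]; case: GA => K [A' [[mA AT] ->]].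
rewrite !subfamily_box -bigcapI.
(* Constraints outside the range of the block map are replaced by [setT]; then at each index at most
   one of [A1 i] and [B1 i] can differ from [setT]. *)
pose A1 i := if `[< exists j, phi1 j = i >] then A' i else setT.
pose B1 i := if `[< exists j, phi2 j = i >] then B' i else setT.
have mA1 i : measurable (A1 i) by rewrite /A1; case: ifP.
have mB1 i : measurable (B1 i) by rewrite /B1; case: ifP.
have AT1 i : i \notin (K `|` L)%fset -> A1 i = setT.
  by rewrite in_fsetU negb_or => /andP[iK _]; rewrite /A1 AT//; case: ifP.
have BT1 i : i \notin (K `|` L)%fset -> B1 i = setT.
  by rewrite in_fsetU negb_or => /andP[_ iL]; rewrite /B1 BT//; case: ifP.
transitivity (P (\bigcap_i X i @^-1` (B1 i `&` A1 i))).
  by congr (P _); apply: eq_bigcap.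
rewrite (@prob_box (K `|` L)%fset); last first.
  split=> [i|i iKL]; first exact: measurableI.
  by rewrite AT1// BT1// setIT.
rewrite (@prob_box (K `|` L)%fset B1)// (@prob_box (K `|` L)%fset A1)//.
rewrite -big_split; apply: eq_bigr => i _ /=.
rewrite /A1 /B1; case: ifPn => [/asboolP[j2 <-]|_].
  rewrite ifN; first by rewrite setIT preimage_setT probability_setT mule1.
  by apply/asboolP => -[j1 /phi12].
by rewrite setTI preimage_setT probability_setT mul1e.
Qed.

End families.
Arguments subfamily {dO Omega I d E J} phi X.

(** * Integration against laws *)

Section laws.
Context (dO : measure_display) (Omega : measurableType dO) (R : realType)
  (P : probability Omega R).

Section same_law.
Context (dT : measure_display) (T : measurableType dT).
Implicit Types X Y : Omega -> T.

Lemma same_law_comp (dU : measure_display) (U : measurableType dU)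
    (g : T -> U) X Y : measurable_fun setT g -> same_law P X Y ->
  same_law P (g \o X) (g \o Y).
Proof.
move=> mg XY A mA; apply: (XY (g @^-1` A)).
by rewrite -[X in measurable X]setTI; exact: mg.
Qed.

Lemma same_law_integrable X Y (h : T -> \bar R) : measurable_fun setT X ->
  measurable_fun setT Y -> measurable_fun setT h -> same_law P X Y ->
  P.-integrable setT (h \o X) -> P.-integrable setT (h \o Y).
Proof.
move=> mX mY mh XY /integrableP[_ iX]; apply/integrableP; split.
  exact: measurableT_comp.
pose X' : {mfun Omega >-> T} := HB.pack X (isMeasurableFun.Build _ _ _ _ _ mX).
pose Y' : {mfun Omega >-> T} := HB.pack Y (isMeasurableFun.Build _ _ _ _ _ mY).
have mah : measurable_fun setT (abse \o h) by exact: measurableT_comp.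
have := @ge0_integral_distribution _ _ _ _ _ P Y' _ mah (fun=> abse_ge0 _).
rewrite /= => <-.
rewrite (eq_measure_integral (distribution P X')) => [|A mA _]; last first.
  by rewrite /= /distribution -(XY A).
by rewrite (@ge0_integral_distribution _ _ _ _ _ P X' _ mah (fun=> abse_ge0 _)).
Qed.

(** Both integrals are integrals of [h] over [D] against the common law. The domain [D] allows
    restriction to the event of unbounded maxima, for a sequence and for its shift. *)
Lemma same_law_integral X Y (h : T -> \bar R) (D : set T) :
  measurable_fun setT X -> measurable_fun setT Y -> measurable_fun setT h ->
  measurable D -> same_law P X Y -> P.-integrable setT (h \o X) ->
  (\int[P]_(w in X @^-1` D) h (X w) = \int[P]_(w in Y @^-1` D) h (Y w))%E.
Proof.
move=> mX mY mh mD XY iX.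
have iY := same_law_integrable mX mY mh XY iX.
have mXD : measurable (X @^-1` D) by rewrite -[X in measurable X]setTI; exact: mX.
have mYD : measurable (Y @^-1` D) by rewrite -[X in measurable X]setTI; exact: mY.
have iXD := integrableS measurableT mXD (@subsetT _ _) iX.
have iYD := integrableS measurableT mYD (@subsetT _ _) iY.
rewrite -(integral_pushforward mX mh iXD)//.
rewrite -(integral_pushforward mY mh iYD)//.
pose X' : {mfun Omega >-> T} := HB.pack X (isMeasurableFun.Build _ _ _ _ _ mX).
pose Y' : {mfun Omega >-> T} := HB.pack Y (isMeasurableFun.Build _ _ _ _ _ mY).
apply: (@eq_measure_integral _ _ _ _ (distribution P Y') (distribution P X')).
by move=> A mA _; exact: XY.
Qed.

End same_law.

Section pairs.
Context (d1 d2 : measure_display) (T1 : measurableType d1)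
  (T2 : measurableType d2).
Variables (X1 : {mfun Omega >-> T1}) (X2 : {mfun Omega >-> T2}).
Hypothesis X12 : independent2 P X1 X2.

Local Notation mu1 := (distribution P X1).
Local Notation mu2 := (distribution P X2).

Lemma measurable_pair : measurable_fun setT (fun w => (X1 w, X2 w)).
Proof. exact: measurable_fun_pair. Qed.

(** Independence says that the joint law agrees with the product measure on rectangles, which
    determines it. *)
Lemma independent2_law (A : set (T1 * T2)) : measurable A ->
  ((mu1 \x mu2) A = pushforward P (fun w => (X1 w, X2 w)) A)%E.
Proof.
move=> mA.
pose X : {mfun Omega >-> (T1 * T2)%type} :=
  HB.pack (fun w => (X1 w, X2 w)) (isMeasurableFun.Build _ _ _ _ _ measurable_pair).
rewrite -[RHS]/(distribution P X A).
apply: product_measure_unique => // B C mB mC.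
Qed.

Variable phi : T1 * T2 -> \bar R.
Hypothesis mphi : measurable_fun setT phi.
Hypothesis iphi : P.-integrable setT (fun w => phi (X1 w, X2 w)).

Lemma independent2_integrable : (mu1 \x mu2)%E.-integrable setT phi.
Proof.
pose X : {mfun Omega >-> (T1 * T2)%type} :=
  HB.pack (fun w => (X1 w, X2 w)) (isMeasurableFun.Build _ _ _ _ _ measurable_pair).
apply/integrableP; split=> //.
rewrite (eq_measure_integral (distribution P X)) => [|A mA _]; last first.
  exact: independent2_law.
rewrite ge0_integral_distribution//; last exact: measurableT_comp.
by case/integrableP : iphi.
Qed.

Lemma independent2_integral :
  (\int[P]_w phi (X1 w, X2 w) = \int[mu1]_x fubini_F mu2 phi x)%E.
Proof.
rewrite integral12_prod_meas1//; last exact: independent2_integrable.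
pose X : {mfun Omega >-> (T1 * T2)%type} :=
  HB.pack (fun w => (X1 w, X2 w)) (isMeasurableFun.Build _ _ _ _ _ measurable_pair).
rewrite (eq_measure_integral (distribution P X)) => [|A mA _]; last first.
  exact: independent2_law.
by rewrite integral_distribution.
Qed.

End pairs.

(** Both pairs have as law the product of the same two marginals. *)
Lemma independent2_same_law (d1 d2 : measure_display) (T1 : measurableType d1)
    (T2 : measurableType d2) (X1 : {mfun Omega >-> T1})
    (X2 X2' : {mfun Omega >-> T2}) :
  independent2 P X1 X2 -> independent2 P X1 X2' -> same_law P X2 X2' ->
  same_law P (fun w => (X1 w, X2 w)) (fun w => (X1 w, X2' w)).
Proof.
move=> X12 X12' X22 A mA; rewrite -independent2_law//.
pose X' : {mfun Omega >-> (T1 * T2)%type} := HB.pack (fun w => (X1 w, X2' w))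
  (isMeasurableFun.Build _ _ _ _ _ (measurable_pair X1 X2')).
rewrite -[RHS]/(distribution P X' A).
apply: product_measure_unique => // B C mB mC.
by rewrite [LHS]X12'//; congr (_ * _)%E; exact/esym/X22.
Qed.

(** Fubini for x 1_D(y): the inner integral over y is x P(Y in D). *)
Lemma integral_independent_event (dT : measure_display) (T : measurableType dT)
    (X : {mfun Omega >-> R}) (Y : {mfun Omega >-> T}) (D : set T) :
  independent2 P X Y -> P.-integrable setT (EFin \o X) -> measurable D ->
  (\int[P]_(w in Y @^-1` D) (X w)%:E = 'E_P[X] * P (Y @^-1` D))%E.
Proof.
move=> XY iX mD.
have mYD : measurable (Y @^-1` D).
  by rewrite -[X in measurable X]setTI; exact: measurable_funPT.
pose phi (z : R * T) := ((z.1)%:E * (\1_D z.2)%:E)%E.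
have mphi : measurable_fun setT phi.
  apply: emeasurable_funM; first by apply/measurable_EFinP; exact: measurable_fst.
  apply/measurable_EFinP; apply: measurableT_comp => //.
have phiE : (fun w => phi (X w, Y w)) = ((EFin \o X) \_ (Y @^-1` D))%E.
  apply/funext => w; rewrite /phi /patch /= indicE.
  rewrite (_ : (w \in Y @^-1` D) = (Y w \in D)); last by [].
  by case: ifP => _; rewrite ?mule1 ?mule0.
rewrite integral_mkcond -phiE independent2_integral//; last first.
  by rewrite phiE -integrable_mkcond//; exact: integrableS iX.
have -> : fubini_F (distribution P Y) phi = (fun x => x%:E * P (Y @^-1` D))%E.
  apply/funext => x; rewrite /fubini_F /phi /=.
  rewrite integralZl//; last first.
    exact: integrable_indic.
  by rewrite integral_indic// setIT.
have <- : (fine (P (Y @^-1` D)))%:E = P (Y @^-1` D) by rewrite fineK// fin_num_measure.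
rewrite integralZr//; last first.
  by apply: integrable_pushforward => //; exact: measurable_funPT.
by rewrite integral_distribution// expectation_def.
Qed.

End laws.

(** * The strong law of large numbers *)

Section sequences.
Context (dO : measure_display) (Omega : measurableType dO) (R : realType)
  (P : probability Omega R) (dU : measure_display) (U : measurableType dU).
Variable xi : nat -> Omega -> U.
Hypotheses (mxi : forall n, measurable_fun setT (xi n))
  (indxi : mutually_independent P xi)
  (eqxi : forall n, same_law P (xi n) (xi 0%N)).

Definition trajectory (x : nat -> Omega -> U) :
  Omega -> prod_space (fun _ : nat => U) := fun w n => x n w.

(** Independence of [xi] is used on the index set [J] moved up by one, with the sets reindexed by
    the predecessor. *)
Lemma mutually_independent_shift :
  mutually_independent P (fun n => xi n.+1).
Proof.
move=> J A mA; have S_inj : {in J &, injective S} by move=> ? ? _ _ [].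
have := indxi (J := [fset i.+1 | i in J]%fset) (A := fun i => A i.-1).
rewrite big_imfset//= => <-; last by move=> _ /imfsetP[i iJ ->] /=; exact: mA.
congr (P _); apply/seteqP; split => [w wA _ /imfsetP[i iJ ->]|w wA i iJ].
  exact: wA.
exact: (wA i.+1 (in_imfset _ _ iJ)).
Qed.

Lemma measurable_trajectory (x : nat -> Omega -> U) :
  (forall n, measurable_fun setT (x n)) -> measurable_fun setT (trajectory x).
Proof. by move=> mx; apply: measurable_to_prod_space. Qed.

(** Stationarity: on a box, both laws are the same finite product of one-dimensional marginals. *)
Lemma trajectory_shift_law :
  same_law P (trajectory xi) (trajectory (fun n => xi n.+1)).
Proof.
apply: (@same_law_generated _ _ _ _ _ _ (boxes (E := fun=> U) (id : nat -> nat))).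
- by apply: (@measurable_boxes nat _ (fun=> U) nat id).
- exact: boxesI.
- exact: boxesT.
- exact: measurable_trajectory.
- by apply: measurable_trajectory => n; exact: mxi.
move=> _ [K [A [boxA ->]]].
have pre (x : nat -> Omega -> U) :
    trajectory x @^-1` box (E := fun=> U) (id : nat -> nat) A =
    \bigcap_i x i @^-1` A i.
  by apply/seteqP; split => [w wA i _|w wA i]; exact: wA.
rewrite !pre (prob_box indxi boxA) (prob_box mutually_independent_shift boxA).
apply: eq_bigr => i _; case: boxA => mA _.
by rewrite [LHS](eqxi i (mA i)) [RHS](eqxi i.+1 (mA i)).
Qed.

(** The blocks are {0}, indexed by [unit], and the positive integers, indexed by [S]. The first
    block lives in a product over [unit], hence the evaluation at [tt]. *)
Lemma head_independent_tail :
  independent2 P (xi 0%N) (trajectory (fun n => xi n.+1)).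
Proof.
move=> A B mA mB.
have ind := @independent2_blocks _ _ _ P nat _ (fun=> U) xi mxi indxi unit nat
  (fun=> 0%N) S.
apply: (ind _ _ _ ((fun x => x tt) @^-1` A) B) => //.
- by move=> [] [].
- by move=> ? ? [].
- rewrite -[X in measurable X]setTI.
  exact: (@measurable_coord unit _ (fun=> U) tt measurableT A mA).
Qed.

End sequences.

(** * The maximal ergodic argument *)

Section maximal_inequality.
Context (R : realType).
Local Notation RN := (prod_space (fun _ : nat => (R : measurableType _))).

(* The maximum of the partial sums x_0 + ... + x_(j-1), j <= n, unfolded from the
   left so that it recurses through the shift. *)
Fixpoint running_max (n : nat) (x : nat -> R) : R :=
  if n is m.+1 then Num.max 0 (x 0%N + running_max m (fun i => x i.+1)) else 0.

Lemma running_max_ge0 n x : 0 <= running_max n x.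
Proof. by case: n => [//|n] /=; rewrite le_max lexx. Qed.

Lemma running_maxS n x : running_max n x <= running_max n.+1 x.
Proof.
elim: n x => [|n IH] x; first exact: running_max_ge0.
by rewrite [leRHS]/= ge_max !le_max lexx/= lerD2l IH orbT.
Qed.

Lemma running_max_homo x : {homo running_max^~ x : m n / (m <= n)%N >-> m <= n}.
Proof. by apply/nondecreasing_seqP => n; exact: running_maxS. Qed.

Lemma partial_sum_le_running_max n (x : nat -> R) : \sum_(i < n) x i <= running_max n x.
Proof.
elim: n x => [|n IH] x; first by rewrite big_ord0.
by rewrite big_ord_recl/= le_max; apply/orP; right; rewrite lerD2l IH.
Qed.

Lemma measurable_shift :
  measurable_fun setT (fun x : RN => (fun i => x i.+1) : RN).
Proof. by apply: measurable_to_prod_space => i; exact: measurable_coord. Qed.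

Lemma measurable_running_max n : measurable_fun setT (running_max n : RN -> R).
Proof.
elim: n => [|n IH]; first exact: measurable_cst.
apply: (measurable_maxr (f := cst 0)) => //.
apply: measurable_funD; first exact: measurable_coord.
exact: measurableT_comp IH measurable_shift.
Qed.

(** Natural bounds make this a countable intersection of countable unions, whence its
    measurability. *)
Definition unbounded_max : set RN :=
  [set x | forall B : nat, exists n, B%:R < running_max n x].

Lemma measurable_unbounded_max : measurable unbounded_max.
Proof.
rewrite (_ : unbounded_max = \bigcap_(B : nat) \bigcup_n
  (running_max n : RN -> R) @^-1` `]B%:R, +oo[); last first.
  apply/seteqP; split => [x xB B _|x xB B].
    by have [n Bn] := xB B; exists n => //=; rewrite in_itv/= andbT.
  by have [n _ /=] := xB B Logic.I; rewrite in_itv/= andbT; exists n.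
apply: bigcapT_measurable => B; apply: bigcupT_measurable => n.
by rewrite -[X in measurable X]setTI; apply: measurable_running_max.
Qed.

(** The running maximum of [x] is that of the shift plus [x 0], cut off below at 0; a fixed finite
    increment does not affect unboundedness. *)
Lemma unbounded_max_shift (x : RN) :
  unbounded_max (fun i => x i.+1) <-> unbounded_max x.
Proof.
split=> xB B.
  (* A natural number above B - x_0; if this difference is negative, [truncn] is 0 and the bound is
     1. *)
  have [n] := xB (Num.truncn (B%:R - x 0%N)).+1.
  move=> /(lt_trans (truncnS_gt _)); rewrite ltrBlDl => Bx.
  by exists n.+1; rewrite /= lt_max Bx orbT.
(* This natural bound exceeds B + x_0; being nonnegative, it rules out n = 0 and the value 0 of the
   outer maximum. *)
have [n] := xB (maxn B (Num.truncn (B%:R + x 0%N)).+1).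
case: n => [|n]; first by rewrite /= ltNge ler0n.
rewrite [running_max _ x]/= lt_max ltNge ler0n/= => Bx; exists n.
suff : B%:R + x 0%N < x 0%N + running_max n (fun i => x i.+1).
  by rewrite addrC ltrD2l.
apply: lt_trans Bx; apply: lt_le_trans (truncnS_gt _) _.
by rewrite ler_nat leq_maxr.
Qed.

End maximal_inequality.

Section strong_law.
Context (dO : measure_display) (Omega : measurableType dO) (R : realType)
  (P : probability Omega R).

Section negative_drift.
Variable xi : nat -> Omega -> R.
Hypotheses (mxi : forall n, measurable_fun setT (xi n))
  (indxi : mutually_independent P xi)
  (eqxi : forall n, same_law P (xi n) (xi 0%N))
  (ixi : P.-integrable setT (EFin \o xi 0%N)).

Local Notation X := (trajectory xi).
Local Notation X' := (trajectory (fun n => xi n.+1)).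
Local Notation U := (@unbounded_max R).

Let mX : measurable_fun setT X. Proof. exact: measurable_trajectory. Qed.
Let mX' : measurable_fun setT X'.
Proof. by apply: measurable_trajectory => n; exact: mxi. Qed.
Let XX' : same_law P X X'. Proof. exact: trajectory_shift_law. Qed.

Let mM n : measurable_fun setT (fun w => running_max n (X w)).
Proof. exact: measurableT_comp (@measurable_running_max R n) mX. Qed.

Let mEM n : measurable_fun [set: prod_space (fun _ : nat => (R : measurableType _))]
  (fun x => (running_max n x)%:E).
Proof. by apply/measurable_EFinP; exact: measurable_running_max. Qed.

Let shift_integrable n :
  P.-integrable setT (fun w => (running_max n (X w))%:E) ->
  P.-integrable setT (fun w => (running_max n (X' w))%:E).
Proof. exact: (same_law_integrable mX mX' (mEM n) XX'). Qed.

(** Induction on n through M_(n+1) <= |xi_0| + M'_n, where M'_n is integrable because it has the law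
    of M_n. *)
Let running_max_integrable n :
  P.-integrable setT (fun w => (running_max n (X w))%:E).
Proof.
elim: n => [|n /shift_integrable IH].
  by rewrite /=; exact: integrable0.
apply: (le_integrable measurableT _ _
  (integrableD measurableT (integrable_abse ixi) IH)).
  by apply/measurable_EFinP; exact: mM.
move=> w _ /=; rewrite lee_fin (ger0_norm (running_max_ge0 n.+1 (X w))).
rewrite ger0_norm ?addr_ge0 ?running_max_ge0//.
rewrite [leLHS]/= ge_max addr_ge0 ?running_max_ge0//=.
by rewrite lerD2r ler_norm.
Qed.

Let A := X @^-1` U.

Let mA : measurable A.
Proof.
rewrite -[X in measurable X]setTI; apply: mX => //.
exact: measurable_unbounded_max.
Qed.

Let AE : A = X' @^-1` U.
Proof. by apply/seteqP; split => w Uw; exact/(unbounded_max_shift (X w)). Qed.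

(* On the event A the increment max(0, xi 0 + M'_n) - M'_n tends to xi 0, while
   its integral over A is nonnegative by shift invariance. *)
Lemma unbounded_max_mean_ge0 : (0 <= \int[P]_(w in A) (xi 0%N w)%:E)%E.
Proof.
pose D n w := running_max n.+1 (X w) - running_max n (X' w).
have iD n : P.-integrable A (EFin \o D n).
  apply: (integrableS measurableT) => //.
  exact: (integrableB measurableT (running_max_integrable n.+1)
    (shift_integrable (running_max_integrable n))).
have D_ge0 n : (0 <= \int[P]_(w in A) (D n w)%:E)%E.
  rewrite /D integralB_EFin//; last 2 first.
  - exact: integrableS (running_max_integrable n.+1).
  - exact: integrableS (shift_integrable (running_max_integrable n)).
  (* Since A is the same event for the shifted sequence, stationarity replaces M'_n by M_n, and the
     integrand M_(n+1) - M_n is nonnegative. *)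
  have -> : (\int[P]_(w in A) (running_max n (X' w))%:E =
             \int[P]_(w in A) (running_max n (X w))%:E)%E.
    rewrite {1}AE; apply/esym.
    apply: (@same_law_integral _ _ _ P _ _ X X'
      (fun x => (running_max n x)%:E) U) => //.
    - exact: measurable_unbounded_max.
    - exact: running_max_integrable.
  rewrite sube_ge0; last first.
    apply/orP; left; apply: integrable_fin_num => //.
    exact: integrableS (running_max_integrable n).
  apply: le_integral => //.
  - exact: integrableS (running_max_integrable n).
  - exact: integrableS (running_max_integrable n.+1).
  - by move=> w _; rewrite lee_fin running_maxS.
have cvgD : (\int[P]_(w in A) (D n w)%:E @[n --> \oo] -->
    \int[P]_(w in A) (xi 0%N w)%:E)%E.
  have [] // := @dominated_convergence _ _ _ P A mA (fun n w => (D n w)%:E)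
    (fun w => (xi 0%N w)%:E) (fun w => (`|xi 0%N w|)%:E).
  - by move=> n; exact: measurable_int (iD n).
  - by apply/measurable_EFinP; exact: measurable_funTS (mxi 0%N).
  (* On A, M'_n eventually exceeds |xi_0|. From then on the maximum with 0 has no effect and [D n w]
     equals xi_0 exactly. *)
  - apply: aeW => w Aw; apply: cvg_near_cst.
    have : U (X' w) by rewrite -[U (X' w)]/((X' @^-1` U) w) -AE.
    move=> /(_ (Num.truncn `|xi 0%N w|).+1)[N].
    move=> /(lt_trans (truncnS_gt _)) HN.
    near=> n; congr EFin; rewrite /D.
    have -> : running_max n.+1 (X w) =
      Num.max 0 (xi 0%N w + running_max n (X' w)) by [].
    suff : 0 <= xi 0%N w + running_max n (X' w).
      by move=> /max_idPr ->; rewrite addrK.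
    have : `|xi 0%N w| <= running_max n (X' w).
      apply: (le_trans (ltW HN)); apply: running_max_homo.
      by near: n; exact: nbhs_infty_ge.
    rewrite -lerBlDl sub0r; apply: le_trans.
    by rewrite -normrN ler_norm.
  - by apply: integrableS (integrable_abse ixi).
  (* Domination by |xi_0|: either D_n = xi_0, or the maximum is 0 and D_n = -M'_n with 0 <= M'_n <=
     -xi_0. *)
  - apply: aeW => w n _; rewrite lee_fin /D.
    have -> : running_max n.+1 (X w) =
      Num.max 0 (xi 0%N w + running_max n (X' w)) by [].
    have := running_max_ge0 n (X' w); set m := running_max n _ => m0.
    rewrite /Num.max; case: ltP => [_|x0]; first by rewrite addrK.
    rewrite sub0r normrN ger0_norm//.
    have xm : m <= - xi 0%N w by rewrite -subr_ge0 -opprD oppr_ge0.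
    by rewrite -normrN (le_trans xm)// ler_norm.
rewrite -(cvg_lim _ cvgD)//; apply: lime_ge; last by apply: nearW => n; exact: D_ge0.
by apply/cvg_ex; eexists; exact: cvgD.
Unshelve. all: by end_near. Qed.

Lemma unbounded_max_null : ('E_P[xi 0%N] < 0)%E -> P A = 0%E.
Proof.
move=> E0; apply/eqP; rewrite -measure_le0 leNgt; apply/negP => PA.
have := unbounded_max_mean_ge0.
pose xi0 : {mfun Omega >-> R} :=
  HB.pack (xi 0%N) (isMeasurableFun.Build _ _ _ _ _ (mxi 0%N)).
pose Y : {mfun Omega >-> prod_space (fun _ : nat => (R : measurableType _))} :=
  HB.pack X' (isMeasurableFun.Build _ _ _ _ _ mX').
(* Written through the shifted sequence, A is an event of the tail, which is independent of xi_0. *)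
rewrite AE (@integral_independent_event _ _ _ _ _ _ xi0 Y)//.
- by rewrite -AE leNgt mule_lt0_gt0.
- exact: head_independent_tail.
- exact: measurable_unbounded_max.
Qed.

(** Off the null event A the running maxima are bounded, and they dominate the partial sums. *)
Lemma ae_partial_sums_bounded : ('E_P[xi 0%N] < 0)%E ->
  {ae P, forall w, exists B : nat, forall n, \sum_(i < n) xi i w <= B%:R}.
Proof.
move=> /unbounded_max_null PA; exists A; split => // w /= nb.
move=> B; apply: contrapT => nB; apply: nb; exists B => n.
rewrite leNgt; apply/negP => Bn; apply: nB; exists n.
exact: lt_le_trans Bn (partial_sum_le_running_max n (X w)).
Qed.

End negative_drift.

End strong_law.

(** * From bounded partial sums to convergence of the means *)

Lemma mutually_independent_comp (dO : measure_display)
    (Omega : measurableType dO) (R : realType) (P : probability Omega R)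
    (I : choiceType) (d d' : I -> measure_display)
    (E : forall i, measurableType (d i)) (E' : forall i, measurableType (d' i))
    (X : forall i, Omega -> E i) (g : forall i, E i -> E' i) :
  (forall i, measurable_fun setT (g i)) -> mutually_independent P X ->
  mutually_independent P (fun i => g i \o X i).
Proof.
move=> mg indX J A mA; apply: (indX J (fun i => g i @^-1` A i)) => i iJ.
by rewrite -[X in measurable X]setTI; apply: mg => //; exact: mA.
Qed.

(** After division by N, each one-sided deviation is at most B / N + 1 / (j + 1); j and then N are
    chosen to make both terms at most e / 2. *)
Lemma cvg_mean_of_bounded_deviations (R : realType) (s : nat -> R) (m : R) :
  (forall j, exists B : nat, forall n,
    \sum_(i < n) (s i - m - j.+1%:R^-1) <= B%:R) ->
  (forall j, exists B : nat, forall n,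
    \sum_(i < n) (m - s i - j.+1%:R^-1) <= B%:R) ->
  (N%:R^-1 * \sum_(i < N) s i) @[N --> \oo] --> m.
Proof.
move=> up lo; apply/cvgrPdist_le => e e0.
have e20 : 0 < e / 2 by rewrite divr_gt0.
have [j je] : exists j : nat, j.+1%:R^-1 <= e / 2.
  exists (Num.truncn (e / 2)^-1); rewrite invf_ple ?posrE//.
  exact/ltW/truncnS_gt.
have [B1 HB1] := up j; have [B2 HB2] := lo j.
pose B : R := (maxn B1 B2)%:R.
near=> N.
have N0 : 0 < N%:R :> R by rewrite ltr0n; near: N; exact: nbhs_infty_gt.
have BN : B <= N%:R * (e / 2).
  rewrite -ler_pdivrMr//; near: N; exact: nbhs_infty_ger.
have up' : \sum_(i < N) s i - N%:R * m - N%:R * j.+1%:R^-1 <= B.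
  apply: le_trans (le_trans (HB1 N) _); last by rewrite ler_nat leq_maxl.
  by rewrite 2!sumrB 2!sumr_const card_ord !mulr_natl.
have lo' : N%:R * m - \sum_(i < N) s i - N%:R * j.+1%:R^-1 <= B.
  apply: le_trans (le_trans (HB2 N) _); last by rewrite ler_nat leq_maxr.
  by rewrite 2!sumrB 2!sumr_const card_ord !mulr_natl.
have jN : N%:R * j.+1%:R^-1 <= N%:R * (e / 2) by rewrite ler_pM2l.
have eN : N%:R * e = N%:R * (e / 2) + N%:R * (e / 2).
  by rewrite -mulrDr -splitr.
rewrite -(ler_pM2l N0) -[X in X * `|_|](ger0_norm (ltW N0)) -normrM mulrBr.
rewrite mulVKf ?gt_eqF//. rewrite ler_norml eN; apply/andP; split.
  rewrite lerNl opprB -lerBlDl.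
  by apply: le_trans (le_trans up' BN); rewrite lerB.
rewrite -lerBlDl; apply: le_trans (le_trans lo' BN).
by rewrite lerB.
Unshelve. all: by end_near. Qed.

Section strong_law_of_large_numbers.
Context (dO : measure_display) (Omega : measurableType dO) (R : realType)
  (P : probability Omega R).
Variable xi : nat -> Omega -> R.
Hypotheses (mxi : forall n, measurable_fun setT (xi n))
  (indxi : mutually_independent P xi)
  (eqxi : forall n, same_law P (xi n) (xi 0%N))
  (ixi : P.-integrable setT (EFin \o xi 0%N)).

(** The slopes 1 and -1 give the upper and the lower deviations of the sample mean, with [b] making
    the drift negative. *)
Lemma ae_affine_partial_sums_bounded (a b : R) :
  a * fine 'E_P[xi 0%N] + b < 0 ->
  {ae P, forall w, exists B : nat, forall n,
    \sum_(i < n) (a * xi i w + b) <= B%:R}.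
Proof.
move=> ab0; pose g (x : R) := a * x + b.
have mg : measurable_fun setT g.
  apply: measurable_funD => //; exact: mulrl_measurable.
have igx : P.-integrable setT (EFin \o (g \o xi 0%N)).
  exact: (integrableD measurableT (integrableZl measurableT a ixi)
    (finite_measure_integrable_cst P b measurableT)).
apply: (@ae_partial_sums_bounded _ _ _ P (fun i => g \o xi i)) => //.
- by move=> n; exact: measurableT_comp.
- exact: (mutually_independent_comp (fun=> mg)).
- by move=> n; apply: same_law_comp.
rewrite unlock /= (_ : (fun w => _) = (fun w => a%:E * (xi 0%N w)%:E + b%:E)%E)//.
rewrite integralD//; last 2 first.
- exact: integrableZl.
- exact: finite_measure_integrable_cst.
rewrite integralZl//.
have := expectation_cst P b; rewrite unlock => ->.
have /fineK <- : (\int[P]_w (xi 0%N w)%:E)%E \is a fin_num.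
  exact: integrable_fin_num.
by rewrite -EFinM -EFinD lte_fin; move: ab0; rewrite unlock.
Qed.

(** Deviations from the mean, lowered by 1 / (j + 1), have negative drift, so their partial sums are
    almost surely bounded above. Only countably many j occur, hence one almost sure event serves
    them all. *)
Lemma strong_law : {ae P, forall w,
  (N%:R^-1 * \sum_(i < N) xi i w) @[N --> \oo] --> fine 'E_P[xi 0%N]}.
Proof.
set m := fine _.
have up : {ae P, forall w j, exists B : nat, forall n,
    \sum_(i < n) (xi i w - m - j.+1%:R^-1) <= B%:R}.
  apply: ae_foralln => j.
  have := @ae_affine_partial_sums_bounded 1 (- m - j.+1%:R^-1).
  rewrite -/m mul1r addrA subrr sub0r oppr_lt0 invr_gt0 ltr0n => /(_ isT).
  apply: filterS => w [B HB]; exists B => n; apply: le_trans (HB n).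
  by rewrite le_eqVlt; apply/orP; left; apply/eqP/eq_bigr => i _; rewrite mul1r addrA.
have lo : {ae P, forall w j, exists B : nat, forall n,
    \sum_(i < n) (m - xi i w - j.+1%:R^-1) <= B%:R}.
  apply: ae_foralln => j.
  have := @ae_affine_partial_sums_bounded (-1) (m - j.+1%:R^-1).
  rewrite -/m mulN1r addrA addNr sub0r oppr_lt0 invr_gt0 ltr0n => /(_ isT).
  apply: filterS => w [B HB]; exists B => n; apply: le_trans (HB n).
  rewrite le_eqVlt; apply/orP; left; apply/eqP/eq_bigr => i _.
  by rewrite mulN1r addrA (addrC m).
by apply: filterS2 up lo => w upw low; exact: (@cvg_mean_of_bounded_deviations R (xi^~ w) m).
Qed.

End strong_law_of_large_numbers.

(** * Conditional expectation by freezing *)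

Section conditional_expectation.
Context (dO : measure_display) (Omega : measurableType dO) (R : realType)
  (P : probability Omega R).

Lemma integrable_distribution_comp (dT : measure_display)
    (T : measurableType dT) (X : {mfun Omega >-> T}) (h : T -> \bar R) :
  (distribution P X).-integrable setT h -> P.-integrable setT (h \o X).
Proof.
move=> /integrableP[mh ih]; apply/integrableP; split.
  exact: measurableT_comp.
have mah : measurable_fun setT (abse \o h) by exact: measurableT_comp.
have := @ge0_integral_distribution _ _ _ _ _ P X _ mah (fun=> abse_ge0 _).
by rewrite /= => <-.
Qed.

Section uniqueness.
Context (dT : measure_display) (T : measurableType dT).

(** Both versions are measurable on [Omega] equipped with the sigma-algebra of [Z], and they have
    equal integrals over each of its sets. They agree off a null set of that sigma-algebra, which is
    also null in [Omega]. *)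
Lemma is_cond_exp_unique (Y : Omega -> R) (Z : Omega -> T) (V1 V2 : Omega -> R) :
  measurable_fun setT Z -> is_cond_exp P Y Z V1 -> is_cond_exp P Y Z V2 ->
  ae_eq P setT (EFin \o V1) (EFin \o V2).
Proof.
move=> mZ [mV1 iV1 V1E] [mV2 iV2 V2E].
pose GT := g_sigma_algebra_preimageType Z.
(* The identity onto the coarser measurable space; its law is the restriction of [P] to the
   sigma-algebra of [Z]. *)
pose id' : Omega -> GT := id.
have mid' : measurable_fun [set: Omega] id'.
  by move=> _ _ [B mB <-]; rewrite !setTI -[X in measurable X]setTI; exact: mZ.
pose idG : {mfun Omega >-> GT} :=
  HB.pack id' (isMeasurableFun.Build _ _ _ _ _ mid').
have mG (A : set GT) : measurable A -> measurable (A : set Omega).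
  by move=> mA; have := mid' measurableT A mA; rewrite setTI.
have mEV1 : measurable_fun [set: GT] (EFin \o V1) by exact/measurable_EFinP.
have mEV2 : measurable_fun [set: GT] (EFin \o V2) by exact/measurable_EFinP.
have iG (V : Omega -> R) (A : set GT) : measurable A ->
    measurable_fun [set: GT] (EFin \o V) -> P.-integrable setT (EFin \o V) ->
    (\int[distribution P idG]_(w in A) (V w)%:E = \int[P]_(w in A) (V w)%:E)%E.
  move=> mA mV iV; apply: (integral_pushforward mid' mV) => //.
  by apply: integrableS iV => //; exact: mG.
have [N [mN N0 VN]] : ae_eq (distribution P idG) setT (EFin \o V1) (EFin \o V2).
  apply: integral_ae_eq => //.
    exact: (integrable_pushforward mid').
  by move=> A _ mA; rewrite /= !iG// V1E// V2E.
by exists N; split => //; exact: mG.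
Qed.

End uniqueness.

Section freezing.
Context (d1 d2 : measure_display) (T1 : measurableType d1)
  (T2 : measurableType d2).
Variables (X1 : {mfun Omega >-> T1}) (X2 X2' : {mfun Omega >-> T2}).
Variable X12 : {mfun Omega >-> (T1 * T2)%type}.
Variable phi : T1 * T2 -> R.
Hypotheses (X12E : forall w, X12 w = (X1 w, X2 w))
  (ind12 : independent2 P X1 X2) (ind12' : independent2 P X12 X2')
  (law2 : same_law P X2' X2) (mphi : measurable_fun setT phi).

Let Y w := phi (X1 w, X2 w).
Let Y' w := phi (X1 w, X2' w).
Hypotheses (iY : P.-integrable setT (EFin \o Y))
  (iYY' : P.-integrable setT (fun w => (Y w * Y' w)%:E)).

Local Notation mu := (distribution P X1).
Local Notation nu := (distribution P X2).
Local Notation nu' := (distribution P X2').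

Let Ephi : T1 * T2 -> \bar R := EFin \o phi.
Let mEphi : measurable_fun setT Ephi. Proof. exact/measurable_EFinP. Qed.

(** The function g_l of the outline. [fine] gives 0 where the section integral is infinite, which
    happens only on a null set of [x]. *)
Definition section_mean (x : T1) : R := fine (\int[nu]_y (phi (x, y))%:E)%E.

Let G := fubini_F nu Ephi.
Let g := section_mean.

Let iEphi : (mu \x nu)%E.-integrable setT Ephi.
Proof. exact: independent2_integrable. Qed.

Let iG : mu.-integrable setT G. Proof. exact: integrable_fubini_F. Qed.

Lemma measurable_section_mean : measurable_fun setT g.
Proof.
by apply: (measurableT_comp _ (measurable_int _ iG)).
Qed.

Let mg := measurable_section_mean.

(** By Fubini almost every section is integrable, and there [fine] loses nothing. *)
Let section_ae : {ae mu, forall x,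
  nu.-integrable setT (fun y => Ephi (x, y)) /\ G x = (g x)%:E}.
Proof.
have /= := ae_integrable1 iEphi; apply: filterS => x ix; split=> //.
by rewrite fineK//; exact: integrable_fin_num.
Qed.

(** Domination by [G]: [fine] keeps finite values and sends infinite ones to 0. *)
Let ig : mu.-integrable setT (EFin \o g).
Proof.
apply: le_integrable iG => //; first exact/measurable_EFinP.
move=> x _; rewrite [G]lock /g /section_mean -lock /=.
rewrite -[X in fine X]/(G x); case: (G x) => [r|/=|/=]; rewrite ?lexx ?leey//.
Qed.

(** An event of the sigma-algebra of [X1] is some X1 in B; Fubini for phi(x, y) 1_B(x) then gives
    the integral of [G] over B. *)
Lemma section_mean_cond_exp : is_cond_exp P Y X1 (g \o X1).
Proof.
have mX1 : measurable_fun [set: g_sigma_algebra_preimageType X1] X1.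
  by move=> _ B mB; rewrite setTI; exists B => //; rewrite setTI.
have igX : P.-integrable setT (EFin \o (g \o X1)).
  exact: (integrable_distribution_comp ig).
split => //; first exact: measurableT_comp mg mX1.
move=> _ [B mB <-]; rewrite setTI.
have mXB : measurable (X1 @^-1` B).
  by rewrite -[X in measurable X]setTI; exact: measurable_funPT.
have mEg : measurable_fun setT (EFin \o g) by exact/measurable_EFinP.
transitivity (\int[mu]_(x in B) (EFin \o g) x)%E.
  apply/esym/(@integral_pushforward _ _ _ _ _ X1) => //.
  exact: integrableS igX.
transitivity (\int[mu]_(x in B) G x)%E.
  apply: ae_eq_integral => //.
  - exact: measurable_funTS.
  - by apply: measurable_funTS; exact: measurable_int iG.
  - by apply: filterS section_ae => x [_ ->].
pose psi (z : T1 * T2) := (Ephi z * (\1_B z.1)%:E)%E.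
have mpsi : measurable_fun setT psi.
  apply: emeasurable_funM => //; apply/measurable_EFinP.
  by apply: measurableT_comp => //; exact: measurable_indic.
have psiE : (fun w => psi (X1 w, X2 w)) = ((EFin \o Y) \_ (X1 @^-1` B))%E.
  apply/funext => w; rewrite /psi /patch /= indicE.
  rewrite (_ : (w \in X1 @^-1` B) = (X1 w \in B))//.
  by case: ifP => _; rewrite ?mule1 ?mule0.
rewrite [RHS]integral_mkcond -psiE (independent2_integral ind12 mpsi); last first.
  by rewrite psiE -integrable_mkcond//; exact: integrableS iY.
rewrite integral_mkcond; apply: eq_integral => x _.
rewrite /fubini_F /psi /patch /= indicE; case: ifP => xB.
  by apply: eq_integral => y _; rewrite mule1.
by rewrite integral0_eq// => y _; rewrite mule0.
Qed.

(** Fubini is used twice. Integrating out [X2'], independent of the pair [X12], leaves phi(x, y)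
    g(x); integrating out [X2] then leaves g(x)^2. *)
Lemma section_mean_sqr :
  (\int[P]_w (Y w * Y' w)%:E = \int[P]_w (g (X1 w) ^+ 2)%:E)%E.
Proof.
pose psi (z : (T1 * T2) * T2) := (phi z.1 * phi (z.1.1, z.2))%:E.
have mpsi : measurable_fun setT psi.
  apply/measurable_EFinP; apply: measurable_funM.
    exact: measurableT_comp.
  apply: measurableT_comp => //; apply: measurable_fun_pair => //.
  exact: measurableT_comp.
have ipsi : P.-integrable setT (fun w => psi (X12 w, X2' w)).
  by apply: eq_integrable iYY' => // w _; rewrite /psi X12E.
have -> : (\int[P]_w (Y w * Y' w)%:E = \int[P]_w psi (X12 w, X2' w))%E.
  by apply: eq_integral => w _; rewrite /psi X12E.
rewrite (independent2_integral ind12' mpsi ipsi).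
have iH := integrable_fubini_F (independent2_integrable ind12' mpsi ipsi).
set H := fubini_F nu' psi.
have mH : measurable_fun setT H by exact: measurable_int iH.
have iHX : P.-integrable setT (fun w => H (X1 w, X2 w)).
  apply: eq_integrable (integrable_distribution_comp iH) => // w _.
  by rewrite /= X12E.
rewrite (integral_distribution mH); last exact: integrable_distribution_comp.
have -> : (\int[P]_w (H \o X12) w = \int[P]_w H (X1 w, X2 w))%E.
  by apply: eq_integral => w _; rewrite /= X12E.
rewrite (independent2_integral ind12 mH iHX).
have mg2 : measurable_fun setT (fun x => (g x ^+ 2)%:E).
  by apply/measurable_EFinP; exact: measurable_funX.
transitivity (\int[mu]_x (g x ^+ 2)%:E)%E; last first.
  by rewrite ge0_integral_distribution// => x; rewrite lee_fin sqr_ge0.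
apply: ae_eq_integral => //.
  by have /measurable_int := integrable_fubini_F (independent2_integrable ind12 mH iHX).
(* The factorisation of [H] is needed only at those x whose section is integrable. *)
apply: filterS section_ae => x [ix Gx] _.
rewrite /fubini_F.
transitivity (\int[nu]_y ((g x)%:E * Ephi (x, y)))%E.
  apply: eq_integral => y _; rewrite /H /fubini_F /psi/=.
  transitivity (\int[nu']_y' (Ephi (x, y) * Ephi (x, y')))%E => //.
  (* Equality of the laws of [X2'] and [X2] turns the inner mean into the same g(x). *)
  rewrite (eq_measure_integral nu) => [|A mA _]; last exact: law2.
  by rewrite integralZl// muleC -Gx.
by rewrite integralZl// -/(fubini_F nu Ephi x) -/G Gx -EFinM expr2.
Qed.

(** The integrand is nonnegative, and by the previous identity its integral is the finite mean of Y
    Y'. *)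
Lemma section_mean_sqr_integrable :
  P.-integrable setT (fun w => (g (X1 w) ^+ 2)%:E).
Proof.
apply/integrableP; split.
  apply/measurable_EFinP; apply: measurable_funX.
  exact: (measurableT_comp mg).
under eq_integral do rewrite gee0_abs ?lee_fin ?sqr_ge0//.
by rewrite -section_mean_sqr; exact: integrable_lty.
Qed.

End freezing.

End conditional_expectation.

(** * The Pick and Freeze estimator *)

Section glue.
Context (p : nat) (d : 'I_p -> measure_display)
  (E : forall i : 'I_p, measurableType (d i)) (u : {set 'I_p}).

Lemma measurable_sub_vec (v : {set 'I_p}) :
  measurable_fun setT (sub_vec v : prod_space E -> sub_space E v).
Proof. by apply: measurable_to_prod_space => i; exact: measurable_coord. Qed.

Lemma glue_in (a : forall j : {i | i \in u}, E (val j))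
    (b : forall j : {i | i \in ~: u}, E (val j)) (i : 'I_p) (iu : i \in u) :
  Defs.glue (a : sub_space E u) (b : sub_space E (~: u)) i = a (exist _ i iu).
Proof.
(* The boolean tested by [glue] is generalised together with its equation, since the branches depend
   on the proof; irrelevance of boolean equality proofs then identifies the indices. *)
have caseE (f : (i \in u) = false -> E i) (c : bool) (e : (i \in u) = c) :
    (if c as c' return (i \in u) = c' -> E i
     then fun h => a (exist _ i h) else f) e = a (exist _ i iu).
  case: c e => e; first by congr (a (exist _ i _)); exact: bool_irrelevance.
  by exfalso; move: (e); rewrite iu.
exact: caseE.
Qed.

Lemma glue_notin (a : forall j : {i | i \in u}, E (val j))
    (b : forall j : {i | i \in ~: u}, E (val j)) (i : 'I_p) (iu : i \in ~: u) :
  Defs.glue (a : sub_space E u) (b : sub_space E (~: u)) i = b (exist _ i iu).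
Proof.
have caseE (g : (i \in u) = false -> i \in ~: u) (c : bool) (e : (i \in u) = c) :
    (if c as c' return (i \in u) = c' -> E i
     then fun h => a (exist _ i h) else fun h => b (exist _ i (g h))) e =
    b (exist _ i iu).
  case: c e => e; first by exfalso; move: (iu); rewrite finset.in_setC e.
  by congr (b (exist _ i _)); exact: bool_irrelevance.
exact: caseE.
Qed.

Lemma measurable_glue : measurable_fun setT
  (fun z : sub_space E u * sub_space E (~: u) => Defs.glue z.1 z.2).
Proof.
apply: measurable_to_prod_space => i.
have [iu|iu] := boolP (i \in u).
  rewrite (_ : (fun z => _) = (fun z : sub_space E u * sub_space E (~: u) =>
    (z.1 : forall j, E (val j)) (exist _ i iu))); last first.
    by apply/funext => z; exact: glue_in.
  exact: (measurableT_comp (@measurable_coord {j | j \in u} _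
    (fun j => E (val j)) (exist _ i iu)) measurable_fst).
rewrite -finset.in_setC in iu.
rewrite (_ : (fun z => _) = (fun z : sub_space E u * sub_space E (~: u) =>
  (z.2 : forall j, E (val j)) (exist _ i iu))); last first.
  by apply/funext => z; exact: glue_notin.
exact: (measurableT_comp (@measurable_coord {j | j \in ~: u} _
  (fun j => E (val j)) (exist _ i iu)) measurable_snd).
Qed.

End glue.

(** * Second moments and limits of the estimator *)

Section moments.
Context (dO : measure_display) (Omega : measurableType dO) (R : realType)
  (P : probability Omega R).

(** Domination by 1 + Y^2. *)
Lemma integrable_of_sqr (Y : Omega -> R) : measurable_fun setT Y ->
  P.-integrable setT (fun w => (Y w ^+ 2)%:E) -> P.-integrable setT (EFin \o Y).
Proof.
move=> mY iY2.
apply: (le_integrable measurableT _ _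
  (integrableD measurableT (finite_measure_integrable_cst P 1 measurableT) iY2)).
  exact/measurable_EFinP.
move=> w _ /=; rewrite lee_fin [leRHS]ger0_norm ?addr_ge0 ?sqr_ge0//.
rewrite -[Y w ^+ 2]real_normK ?num_real//.
have := normr_ge0 (Y w); set y := `|_|; have := sqr_ge0 (y - 1); nra.
Qed.

(** Domination by Y^2 + Z^2. *)
Lemma integrable_mul_of_sqr (Y Z : Omega -> R) : measurable_fun setT Y ->
  measurable_fun setT Z ->
  P.-integrable setT (fun w => (Y w ^+ 2)%:E) ->
  P.-integrable setT (fun w => (Z w ^+ 2)%:E) ->
  P.-integrable setT (fun w => (Y w * Z w)%:E).
Proof.
move=> mY mZ iY2 iZ2.
apply: (le_integrable measurableT _ _ (integrableD measurableT iY2 iZ2)).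
  by apply/measurable_EFinP; exact: measurable_funM.
move=> w _ /=; rewrite lee_fin [leRHS]ger0_norm ?addr_ge0 ?sqr_ge0//.
rewrite ler_norml; have := sqr_ge0 (Y w - Z w); have := sqr_ge0 (Y w + Z w).
by have := sqr_ge0 (Y w); have := sqr_ge0 (Z w); set y := Y w; set z := Z w;
  move=> *; apply/andP; split; nra.
Qed.

Lemma covariance_self (V : Omega -> R) : P.-integrable setT (EFin \o V) ->
  P.-integrable setT (fun w => (V w ^+ 2)%:E) ->
  fine (covariance P V V) =
  fine (\int[P]_w (V w ^+ 2)%:E)%E - fine (\int[P]_w (V w)%:E)%E ^+ 2.
Proof.
move=> iV iV2.
have lV : V \in Lfun P 1 by apply/Lfun1_integrable.
have lV2 : V * V \in Lfun P 1 by apply/Lfun1_integrable.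
rewrite covarianceE// fineB ?fineM ?fin_numM ?expectation_fin_num//.
by rewrite unlock.
Qed.

End moments.

(** The quadratic form is evaluated at the l-th basis vector. *)
Lemma posdef_diag_gt0 (R : realType) (k : nat) (M : 'M[R]_k) (l : 'I_k) :
  posdef M -> 0 < M l l.
Proof.
move=> [_ /(_ (delta_mx l 0))].
rewrite trmx_delta -rowE -colE !mxE; apply.
apply/eqP => /matrixP /(_ l 0); rewrite !mxE !eqxx => /eqP.
by rewrite oner_eq0.
Qed.

Lemma cvg_pick_freeze (R : realType) (k : nat) (y yu : nat -> k.-tuple R)
    (c m s : 'I_k -> R) :
  (forall l, (N%:R^-1 * \sum_(i < N) tnth (y i) l * tnth (yu i) l)
    @[N --> \oo] --> c l) ->
  (forall l, (N%:R^-1 * \sum_(i < N) (tnth (y i) l + tnth (yu i) l) / 2)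
    @[N --> \oo] --> m l) ->
  (forall l, (N%:R^-1 * \sum_(i < N) (tnth (y i) l ^+ 2 + tnth (yu i) l ^+ 2) / 2)
    @[N --> \oo] --> s l) ->
  \sum_(l < k) (s l - m l ^+ 2) != 0 ->
  pick_freeze y yu @ \oo -->
    (\sum_(l < k) (c l - m l ^+ 2)) / (\sum_(l < k) (s l - m l ^+ 2)).
Proof.
move=> cvc cvm cvs s0; rewrite /pick_freeze.
have cvg_sumB (a b : 'I_k -> nat -> R) (a' b' : 'I_k -> R) :
    (forall l, a l @ \oo --> a' l) -> (forall l, b l @ \oo --> b' l) ->
    (\sum_(l < k) (a l N - b l N ^+ 2)) @[N --> \oo] -->
    \sum_(l < k) (a' l - b' l ^+ 2).
  move=> aa' bb'; apply: cvg_big => [|l _]; first exact: add_continuous.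
  apply: cvgB => //; rewrite expr2; under eq_fun do rewrite expr2.
  exact: cvgM.
exact: (cvgM (cvg_sumB _ _ _ _ cvc cvm) (cvgV s0 (cvg_sumB _ _ _ _ cvs cvm))).
Qed.

Section sample_means.
Context (dO : measure_display) (Omega : measurableType dO) (R : realType)
  (P : probability Omega R) (dT : measure_display) (T : measurableType dT).

(** The limit is expressed through a reference variable [V] outside the sample; equality of laws
    carries integrability and expectation between [V] and [W 0]. *)
Lemma strong_law_same_law (W : nat -> {mfun Omega >-> T}) (V : {mfun Omega >-> T})
    (h : T -> R) : mutually_independent P W ->
  (forall n, same_law P (W n) V) -> measurable_fun setT h ->
  P.-integrable setT (EFin \o (h \o V)) ->
  {ae P, forall w, (N%:R^-1 * \sum_(i < N) h (W i w)) @[N --> \oo] -->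
    fine (\int[P]_w (h (V w))%:E)%E}.
Proof.
move=> indW WV mh iV.
have mEh : measurable_fun setT (EFin \o h) by exact/measurable_EFinP.
have VW n : same_law P V (W n) by move=> A mA; exact/esym/WV.
have mV : measurable_fun setT V by [].
have mW n : measurable_fun setT (W n) by [].
have iW : P.-integrable setT (EFin \o (h \o W 0%N)).
  exact: (same_law_integrable mV (mW 0%N) mEh (VW 0%N)).
have -> : (\int[P]_w (h (V w))%:E = 'E_P[h \o W 0%N])%E.
  rewrite unlock.
  have := same_law_integral mV (mW 0%N) mEh measurableT (VW 0%N) iV.
  by rewrite !preimage_setT.
apply: (@strong_law _ _ _ P (fun n => h \o W n)) => //.
- by move=> n; exact: measurableT_comp.
- exact: (mutually_independent_comp (fun=> mh)).
move=> n; apply: same_law_comp => // A mA.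
by rewrite [LHS]WV// [RHS]WV.
Qed.

End sample_means.

(** * Moments of the output and of its frozen copy *)

Section pick_freeze_moments.
Context (R : realType) (dO : measure_display) (Omega : measurableType dO)
  (P : probability Omega R) (p k : nat) (d : 'I_p -> measure_display)
  (E : forall i : 'I_p, measurableType (d i)).
Variables (X : forall i : 'I_p, {RV P >-> E i})
  (f : {mfun prod_space E >-> k.-tuple R}) (u : {set 'I_p})
  (X' : {RV P >-> sub_space E (~: u)}).
Hypotheses (indX : mutually_independent P X)
  (finite2 : ('E_P[fun w => (eucl_norm (output f X w) ^+ 2)%R] < +oo)%E)
  (lawX' : same_law P X' (sub_input X (~: u)))
  (indX' : independent2 P X' (joint X)).

Lemma measurable_joint : measurable_fun setT (joint X).
Proof. by apply: measurable_to_prod_space => i; exact: measurable_funPT. Qed.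

Lemma measurable_sub_input (v : {set 'I_p}) : measurable_fun setT (sub_input X v).
Proof. exact: measurableT_comp (@measurable_sub_vec _ _ _ v) measurable_joint. Qed.

Let X1 : {mfun Omega >-> sub_space E u} := HB.pack (sub_input X u)
  (isMeasurableFun.Build _ _ _ _ _ (@measurable_sub_input u)).
Let X2 : {mfun Omega >-> sub_space E (~: u)} := HB.pack (sub_input X (~: u))
  (isMeasurableFun.Build _ _ _ _ _ (@measurable_sub_input (~: u))).
Let X12 : {mfun Omega >-> (sub_space E u * sub_space E (~: u))%type} :=
  HB.pack (fun w => (X1 w, X2 w))
    (isMeasurableFun.Build _ _ _ _ _ (measurable_pair X1 X2)).

Lemma independent_sub_inputs : independent2 P X1 X2.
Proof.
apply: (@independent2_blocks _ _ _ P _ _ E (fun i => X i) _ indX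
  {i | i \in u} {i | i \in ~: u} val val).
- by move=> i; exact: measurable_funPT.
- exact: val_inj.
- exact: val_inj.
- move=> [i iu] [j ju] /= ij; move: ju; rewrite -ij finset.in_setC.
  by rewrite iu.
Qed.

(** The pair is a measurable function of the joint input, from which [X'] is independent. *)
Lemma independent_pair_copy : independent2 P X12 X'.
Proof.
move=> A B mA mB.
rewrite setIC muleC.
pose h (x : prod_space E) := (sub_vec u x, sub_vec (~: u) x).
have mh : measurable_fun setT h.
  by apply: measurable_fun_pair; exact: measurable_sub_vec.
apply: (indX' mB (B := h @^-1` A)).
by rewrite -[X in measurable X]setTI; exact: mh.
Qed.

Lemma independent_copy : independent2 P X1 X'.
Proof.
move=> A B mA mB; rewrite setIC muleC.
apply: (indX' mB (B := sub_vec u @^-1` A)).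
by rewrite -[X in measurable X]setTI; exact: measurable_sub_vec.
Qed.

Lemma glue_sub_inputs w : Defs.glue (X1 w) (X2 w) = joint X w.
Proof. exact: glueK. Qed.

Lemma measurable_output : measurable_fun setT (output f X).
Proof. exact: measurableT_comp measurable_joint. Qed.

Lemma measurable_frozen_output : measurable_fun setT (frozen_output f X X').
Proof.
apply: measurableT_comp => //.
exact: (measurableT_comp (@measurable_glue _ _ E u) (measurable_pair X1 X')).
Qed.

(** The two outputs are one function of (X_u, X_{~u}) and of (X_u, X'), pairs with the same product
    law. *)
Lemma frozen_output_law : same_law P (output f X) (frozen_output f X X').
Proof.
pose h (z : sub_space E u * sub_space E (~: u)) := f (Defs.glue z.1 z.2).
have mh : measurable_fun setT h by apply: measurableT_comp => //; exact: measurable_glue.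
have -> : output f X = h \o (fun w => (X1 w, X2 w)).
  by apply/funext => w; rewrite /h /= glue_sub_inputs.
apply: (same_law_comp (Y := fun w => (X1 w, X' w)) mh).
apply: independent2_same_law.
- exact: independent_sub_inputs.
- exact: independent_copy.
- by move=> A mA; exact/esym/lawX'.
Qed.

Local Notation Y l := (fun w => tnth (output f X w) l).
Local Notation Yu l := (fun w => tnth (frozen_output f X X' w) l).

Lemma measurable_component l : measurable_fun setT (Y l).
Proof. exact: measurableT_comp (@measurable_tnth _ _ _ l) measurable_output. Qed.

Lemma measurable_frozen_component l : measurable_fun setT (Yu l).
Proof.
exact: measurableT_comp (@measurable_tnth _ _ _ l) measurable_frozen_output.
Qed.

(** Each squared component is at most the squared Euclidean norm. *)
Lemma integrable_component_sqr l : P.-integrable setT (fun w => (Y l w ^+ 2)%:E).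
Proof.
apply/integrableP; split.
  by apply/measurable_EFinP; apply: measurable_funX; exact: measurable_component.
move: finite2; rewrite unlock; apply: le_lt_trans.
have normE w : eucl_norm (output f X w) ^+ 2 = \sum_(l < k) Y l w ^+ 2.
  by rewrite /eucl_norm sqr_sqrtr// sumr_ge0// => i _; exact: sqr_ge0.
apply: ge0_le_integral => //.
- apply: measurableT_comp => //; apply/measurable_EFinP; apply: measurable_funX.
  exact: measurable_component.
- apply/measurable_EFinP; under eq_fun do rewrite normE.
  by apply: measurable_sum => i; apply: measurable_funX; exact: measurable_component.
- move=> w _; rewrite normE gee0_abs ?lee_fin ?sqr_ge0// (bigD1 l)//= lerDl.
  by apply: sumr_ge0 => i _; exact: sqr_ge0.
Qed.

Lemma same_law_components l (h : R -> R) : measurable_fun setT h ->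
  P.-integrable setT (fun w => (h (Y l w))%:E) ->
  P.-integrable setT (fun w => (h (Yu l w))%:E) /\
  (\int[P]_w (h (Yu l w))%:E = \int[P]_w (h (Y l w))%:E)%E.
Proof.
move=> mh iY.
have mH : measurable_fun [set: k.-tuple R] (fun y => (h (tnth y l))%:E).
  by apply/measurable_EFinP; exact: measurableT_comp (@measurable_tnth _ _ _ l).
split.
  exact: (same_law_integrable measurable_output measurable_frozen_output mH
    frozen_output_law).
have := same_law_integral measurable_output measurable_frozen_output mH
  measurableT frozen_output_law iY.
by rewrite !preimage_setT.
Qed.

Lemma integrable_frozen_component_sqr l :
  P.-integrable setT (fun w => (Yu l w ^+ 2)%:E).
Proof.
apply: (same_law_components (h := fun x => x ^+ 2) _ _).1.
  exact: exprn_measurable.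
exact: integrable_component_sqr.
Qed.

Lemma integrable_component l : P.-integrable setT (EFin \o Y l).
Proof.
apply: integrable_of_sqr; first exact: measurable_component.
exact: integrable_component_sqr.
Qed.

Lemma integrable_product l : P.-integrable setT (fun w => (Y l w * Yu l w)%:E).
Proof.
apply: integrable_mul_of_sqr.
- exact: measurable_component.
- exact: measurable_frozen_component.
- exact: integrable_component_sqr.
- exact: integrable_frozen_component_sqr.
Qed.

(** By uniqueness the chosen version [V] is almost surely g_l(X_u), so its second moment is the mean
    of Y_l Y_l^u; its mean is that of Y_l. *)
Lemma covariance_cond_exp_component l :
  let V := cond_exp P (Y l) (sub_input X u) in
  fine (covariance P V V) =
  fine (\int[P]_w (Y l w * Yu l w)%:E)%E - fine (\int[P]_w (Y l w)%:E)%E ^+ 2.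
Proof.
move=> V.
pose phi (z : sub_space E u * sub_space E (~: u)) :=
  tnth (f (Defs.glue z.1 z.2)) l.
have mphi : measurable_fun setT phi.
  apply: (measurableT_comp (@measurable_tnth _ _ _ l)).
  by apply: measurableT_comp => //; exact: measurable_glue.
have phiE w : phi (X1 w, X2 w) = Y l w by rewrite /phi /= glue_sub_inputs.
have YE : (fun w => phi (X1 w, X2 w)) = Y l by apply/funext => w.
have iY : P.-integrable setT (EFin \o (fun w => phi (X1 w, X2 w))).
  by rewrite YE; exact: integrable_component.
have iYY' : P.-integrable setT
    (fun w => (phi (X1 w, X2 w) * phi (X1 w, X' w))%:E).
  by under eq_fun do rewrite phiE; exact: integrable_product.
have lawX2 : same_law P X' X2 by [].
have ceg := section_mean_cond_exp independent_sub_inputs mphi iY.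
rewrite YE in ceg.
have ceV := cond_expP (@measurable_sub_input u) (integrable_component l).
have [mV iV VE] := ceV.
have Vg := is_cond_exp_unique (@measurable_sub_input u) ceV ceg.
have sqrE := section_mean_sqr (X12 := X12) (fun w => erefl) independent_sub_inputs
  independent_pair_copy lawX2 mphi iY iYY'.
have isqr := section_mean_sqr_integrable (X12 := X12) (fun w => erefl)
  independent_sub_inputs independent_pair_copy lawX2 mphi iY iYY'.
have mV2 : measurable_fun setT (fun w => (V w ^+ 2)%:E).
  apply/measurable_EFinP; apply: measurable_funX.
  by apply/measurable_EFinP; exact: measurable_int iV.
have V2g : ae_eq P setT (fun w => (V w ^+ 2)%:E)
    (fun w => (section_mean P X2 phi (X1 w) ^+ 2)%:E).
  by apply: filterS Vg => w /= /(_ Logic.I) [Vw] _; rewrite /V Vw.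
have intV2 : (\int[P]_w (V w ^+ 2)%:E = \int[P]_w (Y l w * Yu l w)%:E)%E.
  transitivity (\int[P]_w (section_mean P X2 phi (X1 w) ^+ 2)%:E)%E.
    by apply: ae_eq_integral => //; exact: measurable_int isqr.
  by rewrite -sqrE; apply: eq_integral => w _; rewrite phiE.
have iV2 : P.-integrable setT (fun w => (V w ^+ 2)%:E).
  apply/integrableP; split=> //.
  under eq_integral do rewrite gee0_abs ?lee_fin ?sqr_ge0//.
  rewrite intV2; exact: integrable_lty (integrable_product l).
rewrite covariance_self// intV2; congr (_ - fine _ ^+ 2).
(* The means agree by testing the conditional expectation on the sure event. *)
apply: VE; exists setT => //.
by rewrite preimage_setT setIT.
Qed.

End pick_freeze_moments.

(** * The almost sure limit of the estimator *)

Unset Implicit Arguments.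
Set Strict Implicit.
Set Printing Implicit Defensive.

Theorem proposition5p1 (R : realType) (dO : measure_display)
    (Omega : measurableType dO) (P : probability Omega R) (p k : nat)
    (d : 'I_p -> measure_display) (E : forall i : 'I_p, measurableType (d i))
    (X : forall i : 'I_p, {RV P >-> E i})
    (f : {mfun prod_space E >-> k.-tuple R})
    (u : {set 'I_p})
    (X' : {RV P >-> sub_space E (~: u)})
    (W : nat -> {RV P >-> (k.-tuple R * k.-tuple R)%type}) :
  mutually_independent P X ->
  ('E_P[fun w => (eucl_norm (output f X w) ^+ 2)%R] < +oo)%E ->
  posdef (cov_mx P (output f X)) ->
  same_law P X' (sub_input X (~: u)) ->
  independent2 P X' (joint X) ->
  mutually_independent P W ->
  (forall n : nat,
     same_law P (W n) (fun w => (output f X w, frozen_output f X X' w))) ->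
  {ae P, forall w : Omega,
     (fun N : nat => pick_freeze (fun i => (W i w).1) (fun i => (W i w).2) N)
       @ \oo --> sobol P f X u}.
Proof.
move=> indX fin2 pd lawX' indX' indW lawW.
(* For k = 0 both sides are 0 / 0 = 0. *)
case: k f W fin2 pd indW lawW => [|k] f W fin2 pd indW lawW.
  apply: aeW => w; rewrite /sobol /mxtrace big_ord0 mul0r.
  apply: cvg_near_cst; apply: nearW => N.
  by rewrite /pick_freeze big_ord0 mul0r.
pose Y l w := tnth (output f X w) l.
pose Yu l w := tnth (frozen_output f X X' w) l.
have mY l : measurable_fun setT (Y l) by exact: measurable_component.
have iY l : P.-integrable setT (EFin \o Y l) by exact: integrable_component.
have iY2 l : P.-integrable setT (fun w => (Y l w ^+ 2)%:E).
  exact: integrable_component_sqr.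
have [iYu EYu] : (forall l, P.-integrable setT (EFin \o Yu l)) /\
    forall l, (\int[P]_w (Yu l w)%:E = \int[P]_w (Y l w)%:E)%E.
  have law l := same_law_components indX lawX' indX' (h := id) (@measurable_id _ _ _) (iY l).
  by split=> l; have [] := law l.
have [iYu2 EYu2] : (forall l, P.-integrable setT (fun w => (Yu l w ^+ 2)%:E)) /\
    forall l, (\int[P]_w (Yu l w ^+ 2)%:E = \int[P]_w (Y l w ^+ 2)%:E)%E.
  have law l := same_law_components indX lawX' indX' (h := fun x => x ^+ 2)
    (@exprn_measurable _ _ _) (iY2 l).
  by split=> l; have [] := law l.
(* The symmetrised terms of the estimator have the mean of a single copy; this serves for the first
   and the second moments. *)
have half (A B : Omega -> R) : P.-integrable setT (EFin \o A) ->
    P.-integrable setT (EFin \o B) ->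
    (\int[P]_w (B w)%:E = \int[P]_w (A w)%:E)%E ->
    P.-integrable setT (fun w => ((A w + B w) / 2)%:E) /\
    (\int[P]_w ((A w + B w) / 2)%:E = \int[P]_w (A w)%:E)%E.
  move=> iA iB AB.
  have E2 : (fun w => ((A w + B w) / 2)%:E) =
      (fun w => (2^-1)%:E * ((EFin \o A) \+ (EFin \o B)) w)%E.
    by apply/funext => w; rewrite /= -EFinD -EFinM mulrC.
  have iAB := integrableD measurableT iA iB.
  split; first by rewrite E2; exact: integrableZl.
  rewrite E2 integralZl// integralD// [X in (_ + X)%E]AB /=.
  have /fineK <- := integrable_fin_num measurableT iA.
  by rewrite -EFinD -EFinM; congr EFin; field.
have mpair : measurable_fun setT (fun w => (output f X w, frozen_output f X X' w)).
  apply: measurable_fun_pair; first exact: measurable_output.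
  exact: measurable_frozen_output.
pose V : {mfun Omega >-> (k.+1.-tuple R * k.+1.-tuple R)%type} :=
  HB.pack (fun w => (output f X w, frozen_output f X X' w))
    (isMeasurableFun.Build _ _ _ _ _ mpair).
have lln h := @strong_law_same_law _ _ _ P _ _ W V h indW lawW.
have mt1 l : measurable_fun [set: k.+1.-tuple R * k.+1.-tuple R]
    (fun z => tnth z.1 l).
  exact: measurableT_comp (@measurable_tnth _ _ _ l) measurable_fst.
have mt2 l : measurable_fun [set: k.+1.-tuple R * k.+1.-tuple R]
    (fun z => tnth z.2 l).
  exact: measurableT_comp (@measurable_tnth _ _ _ l) measurable_snd.
pose m l := fine (\int[P]_w (Y l w)%:E)%E.
pose s l := fine (\int[P]_w (Y l w ^+ 2)%:E)%E.
pose c l := fine (\int[P]_w (Y l w * Yu l w)%:E)%E.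
(* There are finitely many components, so one almost sure event handles all l; likewise for the two
   limits below. *)
have cvc : {ae P, forall w, forall l,
    (N%:R^-1 * \sum_(i < N) tnth (W i w).1 l * tnth (W i w).2 l)
      @[N --> \oo] --> c l}.
  apply: filter_forall => l.
  apply: (lln (fun z => tnth z.1 l * tnth z.2 l)); first exact: measurable_funM.
  exact: integrable_product.
have cvm : {ae P, forall w, forall l,
    (N%:R^-1 * \sum_(i < N) (tnth (W i w).1 l + tnth (W i w).2 l) / 2)
      @[N --> \oo] --> m l}.
  apply: filter_forall => l.
  have [ih Eh] := half _ _ (iY l) (iYu l) (EYu l).
  rewrite /m -Eh.
  apply: (lln (fun z => (tnth z.1 l + tnth z.2 l) / 2)); last exact: ih.
  by apply: measurable_funM => //; exact: measurable_funD.
have cvs : {ae P, forall w, forall l,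
    (N%:R^-1 * \sum_(i < N) (tnth (W i w).1 l ^+ 2 + tnth (W i w).2 l ^+ 2) / 2)
      @[N --> \oo] --> s l}.
  apply: filter_forall => l.
  have [ih Eh] := half _ _ (iY2 l) (iYu2 l) (EYu2 l).
  rewrite /s -Eh.
  apply: (lln (fun z => (tnth z.1 l ^+ 2 + tnth z.2 l ^+ 2) / 2)); last exact: ih.
  by apply: measurable_funM => //; apply: measurable_funD; exact: measurable_funX.
have trS : \tr (cov_mx P (output f X)) = \sum_(l < k.+1) (s l - m l ^+ 2).
  by apply: eq_bigr => l _; rewrite mxE; exact: (covariance_self (iY l) (iY2 l)).
(* The limiting denominator is a sum of positive diagonal entries, nonempty since the dimension is
   now a successor. *)
have S_gt0 : 0 < \sum_(l < k.+1) (s l - m l ^+ 2).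
  rewrite -trS /mxtrace (bigD1 ord0)//= ltr_wpDr ?posdef_diag_gt0//.
  by apply: sumr_ge0 => l _; exact/ltW/posdef_diag_gt0.
have -> : sobol P f X u =
    (\sum_(l < k.+1) (c l - m l ^+ 2)) / \sum_(l < k.+1) (s l - m l ^+ 2).
  rewrite /sobol trS; congr (_ / _); apply: eq_bigr => l _; rewrite mxE.
  have tnthE : (fun w => tnth (cond_exp_vec P (output f X) (sub_input X u) w) l) =
      cond_exp P (Y l) (sub_input X u).
    by apply/funext => w; rewrite tnth_mktuple.
  by rewrite tnthE; exact: covariance_cond_exp_component.
move: cvc cvm cvs; apply: filterS3 => w cvc cvm cvs.
by apply: cvg_pick_freeze => //; rewrite gt_eqF.
Qed.
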